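(* Let $n\geq 5$. Among all nonbipartite connected unicyclic graphs of order $n$ with girth $3$ and domination number $\gamma$, where $\frac{n+1}{3}<\gamma\leq\frac{n}{2}$ and $\gamma=\frac{n-1}{2}$, the least signless Laplacian eigenvalue $q_{min}$ attains its minimum uniquely at $\mathscr{H}_{3,\frac{n-3}{2}}$.
   Context: $Q(G)=D(G)+A(G)$ is the signless Laplacian of $G$ and $q_{min}(G)$ its least eigenvalue; a unicyclic graph is a connected graph with as many edges as vertices; $\gamma$ is the domination number. For odd $n\geq 5$, $\mathscr{H}_{3,\frac{n-3}{2}}$ is the graph of order $n$ consisting of a triangle $v_1v_2v_3v_1$, a path $v_3v_4\cdots v_{\frac{n+5}{2}}$, and one pendant vertex attached to each of $v_4,\ldots,v_{\frac{n+1}{2}}$. *)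

(* Defs.v *)
From HB Require Import structures.
From mathcomp Require Import all_boot all_order all_algebra.
From mathcomp Require Import polyrcf complex.
From mathcomp Require Import boolp classical_sets reals.

Set Implicit Arguments.
Unset Strict Implicit.
Unset Printing Implicit Defensive.

Import Order.TTheory GRing.Theory Num.Theory.
Local Open Scope ring_scope.

(* A simple graph of order n; up to isomorphism its vertex set is 'I_n. *)
Record sgraph (n : nat) := SGraph {
  edge :> rel 'I_n;
  edge_sym : symmetric edge;
  edge_irr : irreflexive edge
}.

Section Graphs.
Variable n : nat.
Implicit Types G H : sgraph n.

Definition isomorphic G H : Prop :=
  exists2 f : 'I_n -> 'I_n, bijective f & forall x y, H (f x) (f y) = G x y.

Definition degree G (x : 'I_n) : nat := #|[set y | G x y]|.

Definition edge_set G : {set {set 'I_n}} :=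
  [set e | [exists x, exists y, G x y && (e == [set x; y])]].

Definition connected G : Prop := forall x y, connect G x y.

Definition unicyclic G : Prop := connected G /\ #|edge_set G| = n.

Definition bipartite G : Prop :=
  exists c : 'I_n -> bool, forall x y, G x y -> c x != c y.

(* The size bound excludes the degenerate ucycles [::] and [:: x; y]. *)
Definition graph_cycle G (c : seq 'I_n) : bool := (2 < size c)%N && ucycleb G c.

Definition has_girth G (g : nat) : Prop :=
  (exists2 c, graph_cycle G c & size c = g) /\
  (forall c, graph_cycle G c -> (g <= size c)%N).

Definition dominating G (S : {set 'I_n}) : bool :=
  [forall x, (x \in S) || [exists y in S, G x y]].

Definition domination_number G : nat :=
  #|[arg min_(S < [set: 'I_n] | dominating G S) #|S|]|.

Lemma dominatingT G : dominating G [set: 'I_n].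
Proof. by apply/forallP => x; rewrite inE. Qed.

Variable R : realType.

Definition adjacency_mx G : 'M[R]_n := \matrix_(i, j) (G i j)%:R.
Definition degree_mx G : 'M[R]_n := diag_mx (\row_i (degree G i)%:R).
Definition signless_laplacian G : 'M[R]_n := degree_mx G + adjacency_mx G.

(* The infimum is a minimum as soon as n > 0: see q_minP. *)
Definition q_min G : R :=
  inf [set a | eigenvalue (signless_laplacian G) a]%classic.

Lemma signless_laplacian_sym G : (signless_laplacian G)^T = signless_laplacian G.
Proof.
rewrite /signless_laplacian linearD /= tr_diag_mx; congr (_ + _).
by apply/matrixP => i j; rewrite !mxE edge_sym.
Qed.

End Graphs.

Arguments q_min {n} R G.

Lemma symmetric_has_eigenvalue (R : rcfType) n (A : 'M[R]_n) :
  (0 < n)%N -> A^T = A -> exists a, eigenvalue A a.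
Proof.
move=> n_gt0 Asym; pose AC := map_mx (real_complex R) A.
have [z] := eigenvalue_closed AC n_gt0.
move=> /[dup] zAC /eigenvalueP [v vA v0].
pose w : 'cV[R[i]]_n := map_mx (@conjc R) v^T.
have conjE m p (B : 'M[R[i]]_(m, p)) : map_mx (@conjc R) (map_mx (@conjc R) B) = B.
  by apply/matrixP => i j; rewrite !mxE conjcK.
have Aw : AC *m w = conjc z *: w.
  have := congr1 (fun M => map_mx (@conjc R) M^T) vA.
  rewrite trmx_mul map_mxM linearZ /= map_mxZ => <-; congr (_ *m _).
  by apply/matrixP => i j; rewrite !mxE -[in LHS]Asym mxE conjc_real.
have vw : (v *m w) 0 0 != 0.
  rewrite mxE psumr_eq0 => [|i _]; last first.
    by rewrite !mxE -sqr_normc exprn_ge0.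
  apply: contra v0 => /allP v0; apply/eqP/rowP => i.
  have := v0 i; rewrite mem_index_enum => /(_ isT).
  by rewrite !mxE -sqr_normc expf_eq0 normr_eq0 => /andP[_ /eqP].
have zreal : z = conjc z.
  apply: (mulIf vw).
  have := mulmxA v AC w; rewrite vA Aw -scalemxAl -scalemxAr => /matrixP/(_ 0 0).
  by rewrite !mxE => ->.
have zE : z = real_complex R (complex.Re z).
  by case: z zreal {zAC vA Aw} => a b [] /eqP; rewrite -addr_eq0 -mulr2n
    mulrn_eq0 => /eqP -> .
exists (complex.Re z); move: zAC.
by rewrite !eigenvalue_root_char -map_char_poly {1}zE fmorph_root.
Qed.

Lemma q_minP n (R : realType) (G : sgraph n) : (0 < n)%N ->
  eigenvalue (signless_laplacian R G) (q_min R G) /\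
  (forall a, eigenvalue (signless_laplacian R G) a -> q_min R G <= a).
Proof.
move=> n_gt0; set A := signless_laplacian R G.
have [a0 a0A] := symmetric_has_eigenvalue n_gt0 (signless_laplacian_sym R G).
have p0 : char_poly A != 0 by rewrite monic_neq0 // char_poly_monic.
have eA a : eigenvalue A a = (a \in rootsR (char_poly A)).
  rewrite eigenvalue_root_char.
  exact: (roots_onP (roots_on_rootsR p0)).
suff [m mA mmin] : exists2 m, eigenvalue A m & forall a, eigenvalue A a -> m <= a.
  have -> : q_min R G = m; last by [].
  apply/eqP; rewrite eq_le; apply/andP; split; last first.
    by apply: lb_le_inf => //; exists m.
  by apply: ge_inf => //; exists m.
have : a0 \in rootsR (char_poly A) by rewrite -eA.
have : sorted <%R (rootsR (char_poly A)) by exact: sorted_roots.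
case: (rootsR (char_poly A)) eA => // x s eA /= xs _.
exists x; first by rewrite eA mem_head.
move=> a; rewrite eA inE => /predU1P[->//|/(allP (order_path_min lt_trans xs))].
exact: ltW.
Qed.

(* Adjacency between 1-based labels a < b, where i : 'I_n has label i.+1.
   Labels 1, ..., (n+5)/2 are the vertices v_1, ..., v_{(n+5)/2}; label
   (n+5)/2 + (a-3) is the pendant vertex attached to v_a. *)
Definition H3_arc (n a b : nat) : bool :=
  [|| (a, b) \in [:: (1, 2); (2, 3); (1, 3)]%N,
      [&& 3 <= a, b == a.+1 & b <= (n + 5)./2]%N
    | [&& 4 <= a, a <= (n + 1)./2 & b == (n + 5)./2 + (a - 3)]%N].

Definition H3_rel (n : nat) : rel 'I_n :=
  fun i j => H3_arc n i.+1 j.+1 || H3_arc n j.+1 i.+1.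

Lemma H3_rel_sym n : symmetric (@H3_rel n).
Proof. by move=> i j; rewrite /H3_rel orbC. Qed.

Lemma H3_rel_irr n : irreflexive (@H3_rel n).
Proof.
move=> i; rewrite /H3_rel orbb /H3_arc !inE !xpair_eqE.
apply/negbTE; rewrite !negb_or; apply/and3P; split.
- by case: (nat_of_ord i) => [|[|[|]]].
- by rewrite (ltn_eqF (ltnSn _)) andbF.
apply/negP => /and3P[i4 ile /eqP iE].
have : (i.+1 <= (n + 5)./2)%N.
  by apply: leq_trans ile _; apply: half_leq; rewrite leq_add2l.
rewrite {1}iE -[leqRHS]addn0 leq_add2l leqn0 subn_eq0 => i3.
by have := leq_trans i4 i3.
Qed.

(* The graph H_{3,(n-3)/2}; meaningful for odd n >= 5 only. *)
Definition H3 (n : nat) : sgraph n := SGraph (@H3_rel_sym n) (@H3_rel_irr n).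

Definition nonbip_unicyclic (n g gamma : nat) (G : sgraph n) : Prop :=
  [/\ unicyclic G, ~ bipartite G, has_girth G g & domination_number G = gamma].

(* Main.v *)
Require Import Defs.
From mathcomp Require Import all_boot all_order all_algebra.
From mathcomp Require Import complex.
From mathcomp Require Import zify ring lra.
From mathcomp Require Import reals.

Set Implicit Arguments.
Unset Strict Implicit.
Unset Printing Implicit Defensive.

Import Order.TTheory GRing.Theory Num.Theory.
Local Open Scope ring_scope.

(* A unicyclic graph with a triangle is the graph of a function p: the triangle
   is a 3-cycle of p and every other vertex is sent to its parent.  Then the
   signless Laplacian form is the sum of the (x_v + x_(p v))^2.

   Write n = 2m+3, so that gamma = m+1.  Since the triangle has length 3, the
   depth modulo 3 is compatible with p on all of G; this gives three dominating
   sets, whence 3 gamma <= n + #supports, i.e. G has m leaves with distinct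
   parents.

   Let x be an eigenvector for q_min(G), with |x_c| maximal on the triangle.  Put
   g = |x_c| on the triangle and g v = g (p v) + |x_v + x_(p v)| elsewhere; thus
   |x| <= g.  Attach to v_3 = c a path carrying in increasing order the values of
   g on the m vertices that are neither on the triangle nor among the m chosen
   leaves; hang on each path vertex one chosen leaf (its own child whenever it
   has one), keeping the increment |x_l + x_(p l)|.  This is a vector on
   H_{3,(n-3)/2} which, edge by edge and vertex by vertex, has at most the energy
   and at least the mass of x, so q_min does not increase.  In case of equality
   it is an eigenvector of H_{3,(n-3)/2}; its modulus then increases strictly
   away from v_3 and is smaller than |x_c| at v_1 and v_2, which forces the
   parents in both graphs to agree. *)

(** * Rayleigh quotients of symmetric matrices *)

(** Over [R[i]] the matrix is Hermitian, hence unitarily diagonalisable. In the spectral coordinates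
    [w] of [x] both sides are combinations of the squared moduli of the [w 0 k], with weights [q] on
    the left and the eigenvalues, which are real, on the right. *)
Lemma rayleigh_ge (R : rcfType) n (A : 'M[R]_n) (q : R) (x : 'rV[R]_n) :
  A^T = A -> (forall a, eigenvalue A a -> q <= a) ->
  q * (x *m x^T) 0 0 <= (x *m A *m x^T) 0 0.
Proof.
move=> Asym qA; pose toC := real_complex R.
pose AC := map_mx toC A; pose xC := map_mx toC x.
have conjR m p (B : 'M[R]_(m, p)) : map_mx (@Num.conj R[i]) (map_mx toC B) = map_mx toC B.
  by apply/matrixP => i j; rewrite !mxE; apply: conjc_real.
have ACherm : AC \is hermsymmx.
  apply: realsym_hermsym.
    by apply/is_hermitianmxP; rewrite expr0 scale1r map_mx_id // map_trmx Asym.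
  by apply/mxOverP => i j; rewrite CrealE !mxE; apply/eqP/conjc_real.
have /hermitian_normalmx /orthomx_spectralP := ACherm.
have /mxOverP dreal := hermitian_spectral_diag_real ACherm.
set P := spectralmx AC; set d := spectral_diag AC in dreal *.
have Pun : P \in unitmx by apply: spectral_unit.
have iP : invmx P = map_mx Num.conj P^T by rewrite invmx_unitary ?spectral_unitarymx.
move=> AE; have dA k : toC q <= d 0 k.
  have dE : d 0 k = toC (complex.Re (d 0 k)).
    have /CrealP := dreal 0 k; case: (d 0 k) => u v [] /eqP.
    by rewrite eq_sym -addr_eq0 -mulr2n mulrn_eq0 => /eqP ->.
  have : eigenvalue AC (d 0 k).
    apply/eigenvalueP; exists (row k P).
      rewrite {1}AE -!mulmxA -row_mul mulKVmx // row_mul row_diag_mx.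
      by rewrite -scalemxAl -rowE.
    apply/negP => /eqP /(congr1 (mulmx^~ (invmx P))).
    rewrite -row_mul mulmxV // mul0mx => /matrixP/(_ 0 k)/eqP.
    by rewrite !mxE eqxx oner_eq0.
  rewrite dE eigenvalue_root_char -map_char_poly fmorph_root -eigenvalue_root_char.
  by move/qA; rewrite lecR.
pose w := xC *m invmx P.
have wE : map_mx Num.conj w^T = P *m xC^T.
  rewrite trmx_mul map_mxM -[in X in _ *m X]map_trmx conjR; congr (_ *m _).
  rewrite iP; apply/matrixP => i j; rewrite !mxE. exact: conjCK.
have xx : toC ((x *m x^T) 0 0) = \sum_k w 0 k * (w 0 k)^*.
  have -> : toC ((x *m x^T) 0 0) = (xC *m xC^T) 0 0.
    by rewrite map_trmx -map_mxM [RHS]mxE.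
  have -> : xC *m xC^T = w *m (P *m xC^T) by rewrite mulmxA mulmxKV.
  rewrite -wE mxE.
  by apply: eq_bigr => k _; rewrite !mxE.
have xAx : toC ((x *m A *m x^T) 0 0) = \sum_k d 0 k * (w 0 k * (w 0 k)^*).
  have -> : toC ((x *m A *m x^T) 0 0) = (xC *m AC *m xC^T) 0 0.
    by rewrite map_trmx -!map_mxM [RHS]mxE.
  have -> : xC *m AC *m xC^T = w *m diag_mx d *m (P *m xC^T).
    by rewrite AE !mulmxA.
  rewrite -wE mxE.
  by apply: eq_bigr => k _; rewrite mul_mx_diag !mxE; rewrite mulrCA !mulrA.
rewrite -lecR [leLHS](rmorphM toC) /= [X in _ * X]xx [leRHS]xAx mulr_sumr.
by apply: ler_sum => k _; rewrite ler_wpM2r // mul_conjC_ge0.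
Qed.

(** * Graphs of functions with a triangle *)

(** The rank [t] counts the steps of [p] down to the root [c]: it forces every orbit into the
    triangle and supports induction from the root outwards. *)
Record pointed_triangle n (p : 'I_n -> 'I_n) (t : 'I_n -> nat) (a b c : 'I_n) : Prop :=
  PointedTriangle {
    pt_neq : b != c;
    pt_a : p a = b;
    pt_b : p b = c;
    pt_c : p c = a;
    pt_root : t c = 0%N;
    pt_step : forall v, v != c -> t v = (t (p v)).+1
  }.

Definition functional_edges n (G : sgraph n) (p : 'I_n -> 'I_n) : Prop :=
  forall i j, G i j = (p i == j) || (p j == i).

Section Functional.
Context {n : nat} {p : 'I_n -> 'I_n} {t : 'I_n -> nat} {a b c : 'I_n}.
Hypothesis pt : pointed_triangle p t a b c.

Lemma pt_ac : a != c.
Proof.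
apply/eqP => ac; have := pt_neq pt; rewrite -(pt_a pt) {1}ac (pt_c pt) ac.
by rewrite eqxx.
Qed.

Lemma pt_tb : t b = 1%N.
Proof. by rewrite (pt_step pt) ?(pt_neq pt) // (pt_b pt) (pt_root pt). Qed.

Lemma pt_ta : t a = 2.
Proof. by rewrite (pt_step pt) ?pt_ac // (pt_a pt) pt_tb. Qed.

Lemma pt_ab : a != b.
Proof. by apply/eqP => ab; have := pt_ta; rewrite ab pt_tb. Qed.

(** The arc from [c] back to [a] goes from depth 0 to depth 2, and 0 = 2 + 1 modulo 3. The
    congruence thus survives around the triangle, and it excludes fixed points and 2-cycles of
    [p]. *)
Lemma pt_mod3 v : (t v = (t (p v)).+1 %[mod 3])%N.
Proof.
have [->|/(pt_step pt) -> //] := eqVneq v c.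
by rewrite (pt_root pt) (pt_c pt) pt_ta.
Qed.

Lemma pt_irr v : p v != v.
Proof. by apply/eqP => E; have := pt_mod3 v; rewrite E; lia. Qed.

Lemma pt_irr2 v : p (p v) != v.
Proof. by apply/eqP => E; have := pt_mod3 v; have := pt_mod3 (p v); rewrite E; lia. Qed.

Lemma pt_ind (P : 'I_n -> Prop) :
  P c -> (forall v, v != c -> P (p v) -> P v) -> forall v, P v.
Proof.
move=> Pc Pp v; elim: {v}(t v) {-2}v (erefl (t v)) => [|k IH] v vk.
  by have [->//|/(pt_step pt)] := eqVneq v c; rewrite vk.
have [->//|vc] := eqVneq v c; apply: Pp => //; apply: IH.
by have := pt_step pt vc; rewrite vk => -[].
Qed.

Lemma parent_edge_inj : injective (fun v => [set v; p v]).
Proof.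
move=> u v E; have : v \in [set u; p u] by rewrite E set21.
rewrite !inE => /orP[/eqP//|/eqP vE].
have : u \in [set v; p v] by rewrite -E set21.
rewrite !inE => /orP[/eqP//|/eqP uE].
by have := pt_irr2 u; rewrite -vE -uE eqxx.
Qed.

Lemma card_parent_edges : #|[set [set v; p v] | v : 'I_n]| = n.
Proof. by rewrite card_imset ?card_ord //; exact: parent_edge_inj. Qed.

Lemma edge_set_functional (G : sgraph n) :
  functional_edges G p -> edge_set G = [set [set v; p v] | v : 'I_n].
Proof.
move=> GE; apply/setP => e; rewrite inE; apply/existsP/imsetP => [[u /existsP[v]]|[v _ ->]].
  rewrite GE => /andP[/orP[/eqP uv|/eqP vu] /eqP ->].
    by exists u; rewrite ?uv.
  by exists v; rewrite ?vu // setUC.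
by exists v; apply/existsP; exists (p v); rewrite GE !eqxx.
Qed.

Lemma connected_functional (G : sgraph n) : functional_edges G p -> connected G.
Proof.
move=> GE; have csym : connect_sym G.
  by apply: sym_connect_sym => u v; exact: edge_sym.
have cc v : connect G v c.
  elim/pt_ind: v => [|v _]; first exact: connect0.
  by apply: connect_trans; apply: connect1; rewrite GE eqxx.
by move=> u v; apply: connect_trans (cc u) _; rewrite csym cc.
Qed.

Lemma unicyclic_functional (G : sgraph n) : functional_edges G p -> unicyclic G.
Proof.
move=> GE; split; first exact: connected_functional.
by rewrite edge_set_functional // card_parent_edges.
Qed.

(** The [n] parent edges are distinct because [p] has no 2-cycle, so they exhaust an edge set of
    size [n]. *)
Lemma functional_edges_of_card (G : sgraph n) :
  #|edge_set G| = n -> (forall v, G v (p v)) -> functional_edges G p.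
Proof.
move=> Gn Gp; have E : [set [set v; p v] | v : 'I_n] = edge_set G.
  apply/eqP; rewrite eqEcard Gn card_parent_edges leqnn andbT.
  apply/subsetP => _ /imsetP[v _ ->]; rewrite inE.
  by apply/existsP; exists v; apply/existsP; exists (p v); rewrite Gp eqxx.
move=> i j; apply/idP/orP => [Gij|[/eqP <-//|/eqP <-]]; last by rewrite edge_sym.
have : [set i; j] \in edge_set G.
  by rewrite inE; apply/existsP; exists i; apply/existsP; exists j; rewrite Gij eqxx.
rewrite -E => /imsetP[v _ /setP ijE].
have ij : i != j by apply/eqP => ij; have := edge_irr G i; rewrite {2}ij Gij.
have := ijE i; have := ijE j; rewrite !inE !eqxx orbT /=.
move=> /esym /orP[]/eqP jE /esym /orP[]/eqP iE.
- by rewrite iE jE eqxx in ij.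
- by right; rewrite jE iE.
- by left; rewrite jE iE.
- by rewrite iE jE eqxx in ij.
Qed.

Lemma signless_laplacian_form (R : realType) (G : sgraph n) (x y : 'rV[R]_n) :
  functional_edges G p ->
  (x *m signless_laplacian R G *m y^T) 0 0 =
  \sum_v (x 0 v + x 0 (p v)) * (y 0 v + y 0 (p v)).
Proof.
(* [N] is the edge-vertex incidence matrix, row [v] standing for the edge between [v] and [p v]. *)
move=> GE; pose N : 'M[R]_n := \matrix_(v, i) ((v == i)%:R + (p v == i)%:R).
have delta u (F : 'I_n -> R) : \sum_i (u == i)%:R * F i = F u.
  rewrite (bigD1 u) //= eqxx mul1r big1 ?addr0 // => i.
  by rewrite eq_sym => /negbTE ->; rewrite mul0r.
have NE (z : 'rV[R]_n) v : (N *m z^T) v 0 = z 0 v + z 0 (p v).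
  rewrite mxE -(delta v (z 0)) -(delta (p v) (z 0)) -big_split /=.
  by apply: eq_bigr => i _; rewrite !mxE mulrDl.
suff -> : signless_laplacian R G = N^T *m N.
  rewrite !mulmxA -mulmxA mxE; apply: eq_bigr => v _.
  by rewrite NE -(trmxK x) -trmx_mul mxE NE trmxK.
apply/matrixP => i j; rewrite /signless_laplacian !mxE.
transitivity (\sum_v ((v == i)%:R * (v == j)%:R + (v == i)%:R * (p v == j)%:R +
   ((p v == i)%:R * (v == j)%:R + (p v == i)%:R * (p v == j)%:R) : R)); last first.
  by apply: eq_bigr => v _; rewrite !mxE; ring.
rewrite !big_split /=.
have sumE u (F : 'I_n -> R) : \sum_v (v == u)%:R * F v = F u.
  by rewrite -[RHS]delta; apply: eq_bigr => v _; rewrite eq_sym.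
rewrite !sumE (eq_bigr (fun v => (v == j)%:R * (p v == i)%:R)) => [|v _]; last by rewrite mulrC.
rewrite sumE GE.
have [->|ij] := eqVneq i j.
  rewrite (negbTE (pt_irr j)) /= mulr1n addr0 add0r addr0.
  rewrite /degree (eq_bigr (fun v => (p v == j)%:R)); last first.
    by move=> v _; case: eqP => _; rewrite ?mulr1 ?mulr0.
  rewrite -natr_sum -natrD; congr (_%:R).
  (* The neighbours of [j] are its parent and its children, and the parent is not also a child. *)
  rewrite (cardsD1 (p j)) inE GE eqxx /=; congr (_ + _)%N.
  rewrite -sum1_card [RHS]big_mkcond /= [LHS]big_mkcond /=; apply: eq_bigr => v _.
  rewrite in_setD1 inE GE [p j == v]eq_sym.
  by have [->|_] := eqVneq v (p j); rewrite ?(negbTE (pt_irr2 j)) //; case: eqP.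
rewrite mulr0n !add0r big1 ?addr0 => [|v _]; last first.
  by have [->|] := eqVneq (p v) i; rewrite ?mul0r // (negbTE ij) mulr0.
rewrite -natrD; congr (_%:R); case: eqP => [<-|_]; last by rewrite add0n.
by rewrite (negbTE (pt_irr2 i)).
Qed.

End Functional.

(** * Domination and supports *)

Lemma connected_frontier n (G : sgraph n) (X : {set 'I_n}) u v :
  connected G -> u \in X -> v \notin X ->
  exists2 w, w \notin X & exists2 z, z \in X & G w z.
Proof.
move=> Gconn uX vX; have [/existsP[w /existsP[z /and3P[wX zX wz]]]|noedge] :=
  boolP [exists w, exists z, [&& w \notin X, z \in X & G w z]].
  by exists w => //; exists z.
have Xclosed : closed G X.
  apply: intro_closed; first by apply: sym_connect_sym => x y; exact: edge_sym.
  move=> z w zw zX; apply: contraR noedge => wX.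
  by apply/existsP; exists w; apply/existsP; exists z; rewrite wX zX edge_sym.
by have := closed_connect Xclosed (Gconn u v); rewrite uX (negbTE vX).
Qed.

(** Starting from the triangle, a vertex adjacent to the part [X] already reached receives that
    neighbour as parent. Connectedness lets [X] grow to all vertices, and the edge count leaves no
    further edge. *)
Lemma functional_graph_of_unicyclic n (G : sgraph n) a b c :
  unicyclic G -> G a b -> G b c -> G c a ->
  exists p, exists2 t, pointed_triangle p t a b c & functional_edges G p.
Proof.
move=> [Gconn Gn] Gab Gbc Gca.
have neq u v : G u v -> u != v by case: eqVneq => // ->; rewrite edge_irr.
have [ab bc ca] : [/\ a != b, b != c & c != a] by rewrite !neq.
pose good (X : {set 'I_n}) p t := [/\ [/\ p a = b, p b = c, p c = a & t c = 0%N], c \in X &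
  forall v, v \in X -> [/\ p v \in X, G v (p v) & v != c -> t v = (t (p v)).+1] ].
suff [p [t [[pa pb pc tc] _ pP]]] : exists p t, good [set: 'I_n] p t.
  have pt : pointed_triangle p t a b c.
    by split=> // v; case: (pP v (in_setT v)) => _ _.
  exists p; exists t => //; apply: (functional_edges_of_card pt Gn) => v.
  by case: (pP v (in_setT v)).
have grow k : forall X p t, (#|~: X| <= k)%N -> good X p t -> exists p t, good [set: 'I_n] p t.
  elim: k => [|k IH] X p t.
    rewrite leqn0 cards_eq0 => /eqP XE gX; exists p, t.
    by rewrite -(setCK X) XE setC0 in gX.
  move=> Xk gX; have [XT|[v vX]] : X = setT \/ exists v, v \notin X.
    have [XT|] := eqVneq X setT; first by left.
    by rewrite -subTset => /subsetPn[v _ vX]; right; exists v.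
    by exists p, t; rewrite -XT.
  have [[pa pb pc tc] cX pP] := gX.
  have [w wX [z zX wz]] := connected_frontier Gconn cX vX.
  have off u : u \in X -> (u == w) = false by move=> uX; apply: contraNF wX => /eqP <-.
  have aX : a \in X by rewrite -pc; case: (pP c cX).
  have bX : b \in X by rewrite -pa; case: (pP a aX).
  apply: (IH (w |: X) (fun u => if u == w then z else p u)
    (fun u => if u == w then (t z).+1 else t u)).
    move: Xk; rewrite (cardsD1 w) in_setC wX add1n ltnS; apply: leq_trans.
    by rewrite subset_leq_card // setCU setDE setIC.
  split; first by rewrite !off.
    by rewrite setU1r.
  move=> u; rewrite in_setU1; have [->|uw] := eqVneq u w.
    by rewrite setU1r // off.
  by move=> /= /pP[puX Gu tu]; rewrite setU1r // off.
pose p v := if v == a then b else if v == b then c else a.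
pose t v := if v == a then 2 else if v == b then 1%N else 0%N.
apply: (grow _ [set a; b; c] p t (leqnn _)); rewrite /good /p /t.
have [ba cb ac] : [/\ b != a, c != b & a != c] by split; rewrite eq_sym.
have E := (negbTE ab, negbTE bc, negbTE ca, negbTE ba, negbTE cb, negbTE ac).
split; rewrite ?inE ?eqxx ?E ?orbT //.
by move=> v; rewrite !inE => /orP[/orP[]|] /eqP->; rewrite !(eqxx, E, orbT, Gab, Gbc, Gca).
Qed.

Lemma domination_number_le n (G : sgraph n) (S : {set 'I_n}) :
  dominating G S -> (domination_number G <= #|S|)%N.
Proof.
by rewrite /domination_number; case: arg_minnP => [|D _ min /min]; first exact: dominatingT.
Qed.

Lemma domination_numberP n (G : sgraph n) :
  exists2 S : {set 'I_n}, dominating G S & #|S| = domination_number G.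
Proof.
rewrite /domination_number; case: arg_minnP => [|D domD _]; first exact: dominatingT.
by exists D.
Qed.

Definition leaves n (p : 'I_n -> 'I_n) : {set 'I_n} := ~: [set p v | v : 'I_n].
Definition supports n (p : 'I_n -> 'I_n) : {set 'I_n} := p @: leaves p.

(* The depth [t] modulo 3 splits the vertices that are neither leaves nor
   supports into three classes; each of them, together with the supports, is
   dominating, since a vertex, its parent and any of its children get the three
   different residues, also on the triangle. *)
Lemma domination_number_supports n (G : sgraph n) p t a b c :
  pointed_triangle p t a b c -> functional_edges G p ->
  (3 * domination_number G <= n + #|supports p|)%N.
Proof.
move=> pt GE; set L := leaves p; set S := supports p.
have SL : [disjoint S & L].
  apply/pred0P => v /=; apply/andP => -[/imsetP[u _ ->]].
  by rewrite inE imset_f.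
pose K := ~: (L :|: S); pose D j := [set v in K | (t v %% 3)%N == j].
have dom j : (j < 3)%N -> dominating G (S :|: D j).
  move=> j3; have inD w : w \notin L -> w \notin S -> (t w %% 3)%N == j -> w \in S :|: D j.
    by move=> wL wS wj; rewrite in_setU inE in_setC in_setU negb_or wL wS wj orbT.
  apply/forallP => v; have [vS|vS] := boolP (v \in S); first by rewrite in_setU vS.
  have nbr w : G v w -> w \in S :|: D j -> [exists y in S :|: D j, G v y].
    by move=> vw wD; apply/existsP; exists w; rewrite wD.
  have Gp : G v (p v) by rewrite GE eqxx.
  apply/orP; have [pS|pS] := boolP (p v \in S).
    by right; apply: (nbr _ Gp); rewrite in_setU pS.
  have [vL|vL] := boolP (v \in L); first by rewrite imset_f in pS.
  have pL : p v \notin L by rewrite inE negbK imset_f.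
  have := vL; rewrite inE negbK => /imsetP[u _ uE].
  have Gu : G v u by rewrite GE uE eqxx orbT.
  have uL : u \notin L by apply: contra vS => uL; rewrite uE imset_f.
  have [uS|uS] := boolP (u \in S); first by right; apply: (nbr _ Gu); rewrite in_setU uS.
  have := pt_mod3 pt v; have := pt_mod3 pt u; rewrite -uE => tu tv.
  have : [|| t v %% 3 == j, t u %% 3 == j | t (p v) %% 3 == j]%N by lia.
  case/or3P => tj; first by left; apply: inD.
    by right; apply: (nbr _ Gu); apply: inD.
  by right; apply: (nbr _ Gp); apply: inD.
have le j : (j < 3)%N -> (domination_number G <= #|S| + #|D j|)%N.
  by move=> j3; apply: leq_trans (domination_number_le (dom j j3)) _; rewrite cardsU leq_subr.
have KE : #|K| = (#|D 0%N| + #|D 1%N| + #|D 2%N|)%N.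
  rewrite -!sum1_card (big_mkcond (mem K)) 3!(big_mkcond (mem (D _))) -!big_split /=.
  apply: eq_bigr => v _; rewrite 3![v \in D _]in_set; case: (v \in K) => //=.
  by case: (t v %% 3)%N (ltn_pmod (t v) (isT : (0 < 3)%N)) => [|[|[|]]].
have := le 0%N isT; have := le 1%N isT; have := le 2%N isT.
(* The three bounds add up to [3 * #|S| + #|K|], with [#|K| = n - #|S| - #|L|] and
   [#|S| <= #|L|]. *)
have : (#|S| <= #|L|)%N by exact: leq_imset_card.
have := cardsC (L :|: S); rewrite -/K card_ord cardsU setIC.
by move: SL; rewrite -setI_eq0 => /eqP ->; rewrite cards0; lia.
Qed.

Lemma leaves_distinct_supports n (p : 'I_n -> 'I_n) m :
  (m <= #|supports p|)%N ->
  exists2 l : seq 'I_n, size l = m & uniq (map p l) /\ {subset l <= leaves p}.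
Proof.
(* [f] picks one leaf child for each support, so it is a right inverse of [p] on supports. *)
move=> mS; pose f v := odflt v [pick u in leaves p | p u == v].
have fP v : v \in supports p -> f v \in leaves p /\ p (f v) = v.
  move=> /imsetP[u uL ->]; rewrite /f; case: pickP => [w /andP[wL /eqP]|/(_ u)] //=.
  by rewrite uL eqxx.
pose s := take m (enum (supports p)).
have sS v : v \in s -> v \in supports p by move/mem_take; rewrite mem_enum.
exists (map f s); first by rewrite size_map size_takel // -cardE.
split; last by move=> _ /mapP[v /sS/fP[] ? _ ->].
rewrite -map_comp (eq_in_map _ id _).1 ?map_id ?take_uniq ?enum_uniq //.
by move=> v /sS/fP[].
Qed.

(** * The graph H3 *)

Section H3graph.
Local Open Scope nat_scope.

(* The ordinals 0, 1, 2 are the triangle v_1, v_2, v_3; 3, ..., m+2 the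
   vertices v_4, ..., v_(m+3), m+3 the pendant neighbour v_(m+4) of v_(m+3),
   and m+4, ..., 2m+2 the pendant vertices attached to v_4, ..., v_(m+2). *)
Definition H3_parent_nat (m i : nat) : nat :=
  if i == 0 then 1 else if i == 1 then 2 else if i == 2 then 0
  else if (i <= m + 3)%N then (i - 1)%N else (i - m.+1)%N.

Definition H3_depth_nat (m i : nat) : nat :=
  if i == 0 then 2 else if i == 1 then 1 else if i == 2 then 0
  else if (i <= m + 3)%N then (i - 2)%N else (i - m.+2)%N.

Definition H3_parent m (i : 'I_m.*2.+3) : 'I_m.*2.+3 := inord (H3_parent_nat m i).
Definition H3_depth m (i : 'I_m.*2.+3) : nat := H3_depth_nat m i.

Lemma H3_parentE m (i : 'I_m.*2.+3) : H3_parent i = H3_parent_nat m i :> nat.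
Proof. by rewrite inordK // /H3_parent_nat; have := ltn_ord i; do ?case: ifP; lia. Qed.

Definition H3_v1 {m} : 'I_m.*2.+3 := inord 0.
Definition H3_v2 {m} : 'I_m.*2.+3 := inord 1.
Definition H3_v3 {m} : 'I_m.*2.+3 := inord 2.

Lemma H3_pointed_triangle m :
  pointed_triangle (@H3_parent m) (@H3_depth m) H3_v1 H3_v2 H3_v3.
Proof.
have [v1 v2 v3] : [/\ @H3_v1 m = 0 :> nat, @H3_v2 m = 1 :> nat & @H3_v3 m = 2 :> nat].
  by rewrite !inordK.
split.
- by rewrite -val_eqE /= v2 v3.
- by apply: val_inj; rewrite /= H3_parentE v1 v2.
- by apply: val_inj; rewrite /= H3_parentE v2 v3.
- by apply: val_inj; rewrite /= H3_parentE v3 v1.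
- by rewrite /H3_depth v3.
- move=> v; rewrite -val_eqE /= v3 /H3_depth H3_parentE /H3_depth_nat /H3_parent_nat.
  case: (nat_of_ord v) (ltn_ord v) => [|[|[|k]]] //= vn _; have [km|km] := leqP k.+3 (m + 3).
    by do ?case: ifP; lia.
  by do ?case: ifP; lia.
Qed.

Lemma H3_parent_natP m i :
  [\/ i = 0 /\ H3_parent_nat m i = 1, i = 1 /\ H3_parent_nat m i = 2,
      i = 2 /\ H3_parent_nat m i = 0
    | 2 < i <= m + 3 /\ H3_parent_nat m i = i - 1 \/
      m + 3 < i /\ 2 < i /\ H3_parent_nat m i = i - m.+1].
Proof.
rewrite /H3_parent_nat; case: i => [|[|[|i]]] //=.
- by constructor 1.
- by constructor 2.
- by constructor 3.
- by constructor 4; case: ifP => im; [left | right]; lia.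
Qed.

Lemma H3_functional_edges m : functional_edges (H3 m.*2.+3) (@H3_parent m).
Proof.
have h5 : (m.*2.+3 + 5)./2 = m + 4 by lia.
have h1 : (m.*2.+3 + 1)./2 = m + 2 by lia.
have arcP i j : H3_arc m.*2.+3 i.+1 j.+1 -> i < m.*2.+3 -> j < m.*2.+3 ->
    H3_parent_nat m i = j \/ H3_parent_nat m j = i.
  rewrite /H3_arc !inE !xpair_eqE h5 h1.
  case/or3P => [tri|/and3P[i3 /eqP jE jm]|/and3P[i4 im /eqP jE]] in' jn.
    by case/or3P: tri => /andP[/eqP[->] /eqP[->]]; [left | left | right].
  - by right; have := H3_parent_natP m j; case => -[]; lia.
  - by right; have := H3_parent_natP m j; case => -[]; lia.
have parentP i : i < m.*2.+3 -> H3_arc m.*2.+3 i.+1 (H3_parent_nat m i).+1 ||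
    H3_arc m.*2.+3 (H3_parent_nat m i).+1 i.+1.
  rewrite /H3_arc h5 h1 => im; have := H3_parent_natP m i; case.
  - by move=> [-> ->].
  - by move=> [-> ->].
  - by move=> [-> ->]; rewrite orbC.
  case=> [[i3 ->]|[i3 [_ ->]]]; apply/orP; right; apply/or3P.
    by constructor 2; lia.
  by constructor 3; lia.
move=> i j; rewrite -!val_eqE /= !H3_parentE.
apply/idP/idP => [/orP[] /arcP/(_ (ltn_ord _) (ltn_ord _))[] E|];
  try by rewrite E eqxx ?orbT.
by rewrite /H3_rel => /orP[]/eqP <-; last rewrite orbC; exact: parentP.
Qed.

Lemma H3_domination_number m : domination_number (H3 m.*2.+3) = m.+1.
Proof.
have HE := @H3_functional_edges m.
have nbr (S : {set 'I_m.*2.+3}) v u : u \in S -> H3_parent v = u \/ H3_parent u = v ->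
    [exists y in S, H3 m.*2.+3 v y].
  by move=> uS vu; apply/existsP; exists u; rewrite uS HE; case: vu => ->; rewrite eqxx ?orbT.
apply/eqP; rewrite eqn_leq; apply/andP; split.
  (* The vertices v_3, ..., v_(m+3), ordinals 2 to [m + 2], dominate. *)
  pose base (j : 'I_m.+1) : 'I_m.*2.+3 := inord (j + 2).
  have baseE j : base j = (j + 2)%N :> nat.
    by rewrite inordK //; have := ltn_ord j; lia.
  have in_base (v : 'I_m.*2.+3) : (2 <= v <= m + 2)%N -> v \in [set base j | j : 'I_m.+1].
    move=> vm; apply/imsetP; exists (inord (v - 2)) => //; apply: val_inj.
    by rewrite /= baseE inordK; lia.
  apply: leq_trans (domination_number_le (S := [set base j | j : 'I_m.+1]) _) _; last first.
    by rewrite (leq_trans (leq_imset_card _ _)) ?card_ord.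
  apply/forallP => v; have [/in_base -> //|vm] := boolP (2 <= v <= m + 2)%N.
  apply/orP; right; have [v0|v0] := eqVneq (v : nat) 0%N.
    apply: (nbr _ _ H3_v3); first by apply: in_base; rewrite inordK; lia.
    by right; apply: val_inj; rewrite /= H3_parentE v0 inordK.
  apply: (nbr _ _ (H3_parent v)); last by left.
  by apply: in_base; rewrite H3_parentE /H3_parent_nat; have := ltn_ord v; do ?case: ifP; lia.
have [S /forallP domS <-] := domination_numberP (H3 m.*2.+3).
(* Lower bound: v_1 and the [m] pendant vertices have closed neighbourhoods in distinct blocks, so a
   dominating set meets all [m.+1] blocks. *)
pose block (v : 'I_m.*2.+3) : 'I_m.+1 :=
  inord (if (v <= 2)%N then 0%N else if (v <= m + 2)%N then (v - 2)%N
         else if v == (m + 3)%N :> nat then m else (v - m.+3)%N).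
suff -> : m.+1 = #|block @: S| by exact: leq_imset_card.
rewrite -[LHS]card_ord -cardsT; apply: eq_card => j; rewrite inE; apply/esym/imsetP.
have jm := ltn_ord j.
pose w : 'I_m.*2.+3 := inord
  (if j == 0 :> nat then 0 else if j == m :> nat then m + 3 else j + m.+3).
have wE : w = (if j == 0 :> nat then 0 else if j == m :> nat then m + 3 else j + m.+3) :> nat.
  by rewrite inordK //; do ?case: ifP; lia.
have blockE u : u = w \/ H3 m.*2.+3 w u -> block u = j.
  move=> uw; apply: val_inj; rewrite /= inordK; last by have := ltn_ord u; do ?case: ifP; lia.
  case: uw => [->|]; first by rewrite wE; do ?case: ifP; lia.
  rewrite HE -!val_eqE /= !H3_parentE /H3_parent_nat wE; have := ltn_ord u; do ?case: ifP; lia.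
have /orP[wS|/existsP[u /andP[uS wu]]] := domS w.
  by exists w => //; rewrite blockE //; left.
by exists u => //; rewrite blockE //; right.
Qed.

Lemma H3_nonbip_unicyclic m : nonbip_unicyclic 3 m.+1 (H3 m.*2.+3).
Proof.
have pt := H3_pointed_triangle m; have HE := @H3_functional_edges m.
have [H12 H23 H31] : [/\ H3 m.*2.+3 H3_v1 H3_v2, H3 m.*2.+3 H3_v2 H3_v3 & H3 m.*2.+3 H3_v3 H3_v1].
  by rewrite !HE (pt_a pt) (pt_b pt) (pt_c pt) !eqxx.
split; [exact (unicyclic_functional pt HE) | | | exact: H3_domination_number].
  move=> [f fP]; have := fP _ _ H12; have := fP _ _ H23; have := fP _ _ H31.
  by case: (f _); case: (f _); case: (f _).
split; last by move=> c /andP[].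
exists [:: H3_v1; H3_v2; H3_v3] => //; apply/andP; split=> //; apply/andP; split.
  by apply/and4P.
by rewrite /= !inE negb_or (pt_ab pt) (pt_ac pt) (pt_neq pt).
Qed.

End H3graph.

(** * Rayleigh quotients of the signless Laplacian *)

Lemma linear_term_eq0 (R : realFieldType) (B F : R) :
  (forall e, 0 <= e *+ 2 * B + e ^+ 2 * F) -> B = 0.
Proof.
move=> H; apply/eqP/negPn/negP => B0.
have F0 : 0 <= F by have := H 1; have := H (-1); lra.
have F1 : F + 1 != 0 by lra.
(* Dividing by [F + 1] rather than [F] covers [F = 0]; the expression is then a negative multiple of
   a nonzero square. *)
have := H (- B / (F + 1)); apply/negP; rewrite -ltNge.
have -> : (- B / (F + 1)) *+ 2 * B + (- B / (F + 1)) ^+ 2 * F =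
  - ((B / (F + 1)) ^+ 2 * (F + 2)) by field.
rewrite oppr_lt0 mulr_gt0 //; last by lra.
by rewrite exprn_even_gt0 //= mulf_neq0 // invr_eq0.
Qed.

Lemma sum_eq_termwise (R : numDomainType) (I : finType) (F G : I -> R) :
  (forall i, F i <= G i) -> \sum_i F i = \sum_i G i -> forall i, F i = G i.
Proof.
move=> FG E i; have : \sum_i (G i - F i) = 0 by rewrite sumrB E subrr.
move/psumr_eq0P => H; apply/esym/eqP; rewrite -subr_eq0 H // => j _.
by rewrite subr_ge0.
Qed.

Section Rayleigh.
Context {R : realType} {n : nat} {p : 'I_n -> 'I_n} {t : 'I_n -> nat} {a b c : 'I_n}.
Hypothesis pt : pointed_triangle p t a b c.
Variable G : sgraph n.
Hypothesis GE : functional_edges G p.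
Local Notation q := (q_min R G).

Let n_gt0 : (0 < n)%N.
Proof. exact: leq_ltn_trans (ltn_ord c). Qed.

Lemma q_min_rayleigh (y : 'I_n -> R) :
  q * \sum_i y i ^+ 2 <= \sum_i (y i + y (p i)) ^+ 2.
Proof.
have := @rayleigh_ge _ _ _ _ (\row_i y i) (signless_laplacian_sym R G) (q_minP R G n_gt0).2.
rewrite (signless_laplacian_form pt _ _ GE) mxE; congr (_ * _ <= _).
  by apply: eq_bigr => i _; rewrite !mxE expr2.
by apply: eq_bigr => i _; rewrite !mxE expr2.
Qed.

(** First variation: at [y + e z] the Rayleigh inequality is a quadratic in [e] without constant
    term, so its linear coefficient vanishes. *)
Lemma q_min_minimizer (y z : 'I_n -> R) :
  \sum_i (y i + y (p i)) ^+ 2 = q * \sum_i y i ^+ 2 ->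
  \sum_i (y i + y (p i)) * (z i + z (p i)) = q * \sum_i y i * z i.
Proof.
move=> yq; apply/eqP; rewrite -subr_eq0; apply/eqP.
apply: (@linear_term_eq0 _ _ (\sum_i (z i + z (p i)) ^+ 2 - q * \sum_i z i ^+ 2)) => e.
have := q_min_rayleigh (fun i => y i + e * z i); rewrite -subr_ge0.
have -> : \sum_i (y i + e * z i + (y (p i) + e * z (p i))) ^+ 2 =
  \sum_i (y i + y (p i)) ^+ 2 + e *+ 2 * (\sum_i (y i + y (p i)) * (z i + z (p i)))
  + e ^+ 2 * \sum_i (z i + z (p i)) ^+ 2.
  by rewrite !mulr_sumr -!big_split /=; apply: eq_bigr => i _; ring.
have -> : \sum_i (y i + e * z i) ^+ 2 =
  \sum_i y i ^+ 2 + e *+ 2 * (\sum_i y i * z i) + e ^+ 2 * \sum_i z i ^+ 2.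
  by rewrite !mulr_sumr -!big_split /=; apply: eq_bigr => i _; ring.
by rewrite yq; congr (_ <= _); ring.
Qed.

Let sum_delta u (F : 'I_n -> R) : \sum_i F i * (i == u)%:R = F u.
Proof.
rewrite (bigD1 u) //= eqxx mulr1 big1 ?addr0 // => i /negbTE ->.
by rewrite mulr0.
Qed.

Let sum_delta_parent u (F : 'I_n -> R) :
  \sum_i F i * (p i == u)%:R = \sum_(i | p i == u) F i.
Proof.
rewrite [RHS]big_mkcond; apply: eq_bigr => i _.
by case: (p i == u); rewrite ?mulr1 ?mulr0.
Qed.

(** The first variation is tested against the indicator of [u], which sees only the edges to the
    parent and to the children of [u]. *)
Lemma q_min_vertex_eq (y : 'I_n -> R) u :
  \sum_i (y i + y (p i)) ^+ 2 = q * \sum_i y i ^+ 2 ->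
  (y u + y (p u)) + \sum_(i | p i == u) (y i + y u) = q * y u.
Proof.
move=> /(q_min_minimizer (fun i => (i == u)%:R)); rewrite sum_delta => <-.
under [RHS]eq_bigr => i _ do rewrite mulrDr.
rewrite [RHS]big_split /= sum_delta sum_delta_parent; congr (_ + _).
by apply: eq_bigr => i /eqP ->.
Qed.

(** The indicator of the leaf [u] has Rayleigh quotient 1. Were it a minimiser, the vertex equation
    at [p u], where it vanishes, would read 1 = 0. *)
Lemma q_min_lt1 u : (forall i, p i != u) -> q < 1.
Proof.
move=> pu; pose z i : R := (i == u)%:R.
have zz : \sum_i z i ^+ 2 = 1.
  rewrite -(sum_delta u (fun => 1)); apply: eq_bigr => i _.
  by rewrite /z mul1r -natrX; case: (i == u).
have zp : \sum_i (z i + z (p i)) ^+ 2 = 1.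
  by rewrite -zz; apply: eq_bigr => i _; rewrite /z (negbTE (pu i)) addr0.
rewrite lt_neqAle; apply/andP; split; last first.
  by have := q_min_rayleigh z; rewrite zz zp mulr1.
apply/negP => /eqP q1; have := @q_min_vertex_eq z (p u).
rewrite zz zp q1 => /(_ (esym (mulr1 1))); rewrite /z !(negbTE (pu _)) mulr0 add0r.
rewrite (bigD1 u) //= eqxx addr0 big1 => [|i /andP[_ /negbTE ->]]; last by rewrite addr0.
by rewrite !(addr0, add0r) => /eqP; rewrite oner_eq0.
Qed.

End Rayleigh.

(** The vector is produced before [p], because the root of the triangle is going to be chosen
    according to it. *)
Lemma q_min_eigenvector (R : realType) n (G : sgraph n) : (0 < n)%N ->
  exists2 x : 'I_n -> R, exists v, x v != 0 &
    forall p t a b c, pointed_triangle p t a b c -> functional_edges G p ->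
    \sum_i (x i + x (p i)) ^+ 2 = q_min R G * \sum_i x i ^+ 2.
Proof.
move=> n0; have [/eigenvalueP[x xQ x0] _] := q_minP R G n0.
exists (x 0).
  apply/existsP; apply: contraR x0; rewrite negb_exists => /forallP x0.
  by apply/eqP/rowP => v; rewrite mxE; apply/eqP; have := x0 v; rewrite negbK.
move=> p t a b c pt GE.
have := signless_laplacian_form (R := R) pt x x GE; rewrite xQ -scalemxAl !mxE => E.
transitivity (\sum_v (x 0 v + x 0 (p v)) * (x 0 v + x 0 (p v))) => [//|].
by rewrite -E; congr (_ * _); apply: eq_bigr => i _; rewrite !mxE expr2.
Qed.

(** * Comparison of two graphs along a vertex bijection *)

(** Here [u] stands for the common value at the two other triangle vertices and [r] for the root
    value: [u] is negative, and [r] exceeds its modulus by [(q - 2) * u]. *)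
Lemma triangle_value_lt (R : realFieldType) (q u r : R) :
  q < 1 -> 0 < r -> r = (q - 3) * u -> `|u| < r.
Proof.
move=> q1 r0 rE; have u0 : u < 0.
  by rewrite -(nmulr_rgt0 _ (_ : q - 3 < 0)) -?rE //; lra.
have : 0 < (q - 2) * u by rewrite nmulr_rgt0 //; lra.
by rewrite ltr_norml => uq; apply/andP; split; lra.
Qed.

Section Transplant.
Context {R : realFieldType} {n : nat}.
Context {p : 'I_n -> 'I_n} {t : 'I_n -> nat} {a b c : 'I_n}.
Context {p' : 'I_n -> 'I_n} {t' : 'I_n -> nat} {a' b' c' : 'I_n}.
Hypothesis pt : pointed_triangle p t a b c.
Hypothesis pt' : pointed_triangle p' t' a' b' c'.

Local Notation outer i := (i \notin [:: a'; b'; c']).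
Hypothesis outer_parent : forall i, outer i -> p' i \notin [:: a'; b'].

Variables (psi : 'I_n -> 'I_n) (x h : 'I_n -> R) (q q' : R).
Hypothesis psi_inj : injective psi.
Hypothesis psi_tri : [/\ psi a' = a, psi b' = b & psi c' = c].
Hypothesis x_eigen : \sum_i (x i + x (p i)) ^+ 2 = q * \sum_i x i ^+ 2.
Hypothesis x_neq0 : exists v, x v != 0.
Hypothesis x_tri : `|x a| <= x c /\ `|x b| <= x c.
Hypothesis h_root : h c' = x c.
Hypothesis h_mono : forall i, outer i -> h (p' i) <= h i.
Hypothesis h_step : forall i, outer i -> h i - h (p' i) <= `|x (psi i) + x (p (psi i))|.
Hypothesis h_dom : forall i, outer i -> `|x (psi i)| <= h i.

(** Signs alternating with the depth turn the sum across an edge outside the triangle into an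
    increment of [h], up to sign. By [outer_parent] such an edge ends at [c'] or at an outer vertex,
    where this formula is valid. *)
Let y i := if i \in [:: a'; b'] then x (psi i) else (-1) ^+ t' i * h i.

Let outerP i : [\/ i = a', i = b', i = c' | outer i].
Proof.
rewrite !inE; have [->|_] := eqVneq i a'; first by constructor 1.
have [->|_] := eqVneq i b'; first by constructor 2.
by have [->|_] := eqVneq i c'; [constructor 3 | constructor 4].
Qed.

Let outer_neq i : outer i -> [/\ i != a', i != b' & i != c'].
Proof. by rewrite !inE !negb_or => /and3P. Qed.

Let ya : y a' = x a.
Proof. by rewrite /y mem_head; case: psi_tri => ->. Qed.

Let yb : y b' = x b.
Proof. by rewrite /y !inE eqxx orbT; case: psi_tri => _ ->. Qed.

Let yc : y c' = x c.
Proof.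
rewrite /y !inE (pt_root pt') mul1r ![c' == _]eq_sym.
by rewrite (negbTE (pt_ac pt')) (negbTE (pt_neq pt')) h_root.
Qed.

Let y_outer i : outer i -> y i = (-1) ^+ t' i * h i.
Proof. by case/outer_neq => ia ib _; rewrite /y !inE (negbTE ia) (negbTE ib). Qed.

Let y_step i : outer i -> y i + y (p' i) = (-1) ^+ t' i * (h i - h (p' i)).
Proof.
move=> io; have [_ _ ic] := outer_neq io.
rewrite y_outer // /y (negbTE (outer_parent io)) (pt_step pt' ic) exprS; ring.
Qed.

Let sqr_signM k (z : R) : ((-1) ^+ k * z) ^+ 2 = z ^+ 2.
Proof. by rewrite exprMn -exprM mulnC exprM sqrrN expr1n expr1n mul1r. Qed.

Let y_energy i : (y i + y (p' i)) ^+ 2 <= (x (psi i) + x (p (psi i))) ^+ 2.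
Proof.
have [pa pb pc] := psi_tri.
case: (outerP i) => [->|->|->|io].
- by rewrite (pt_a pt') ya yb pa (pt_a pt).
- by rewrite (pt_b pt') yb yc pb (pt_b pt).
- by rewrite (pt_c pt') yc ya pc (pt_c pt).
rewrite y_step // sqr_signM -[leRHS]real_normK ?num_real //.
by rewrite ler_sqr ?nnegrE ?subr_ge0 ?h_step ?h_mono.
Qed.

Let y_mass i : x (psi i) ^+ 2 <= y i ^+ 2.
Proof.
have [pa pb pc] := psi_tri.
case: (outerP i) => [->|->|->|io]; rewrite ?pa ?pb ?pc ?ya ?yb ?yc //.
rewrite y_outer // sqr_signM -[leLHS]real_normK ?num_real //.
have := h_dom io; have := normr_ge0 (x (psi i)) => x0 xh.
by rewrite ler_sqr ?nnegrE // (le_trans x0).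
Qed.

Let sum_psi (F : 'I_n -> R) : \sum_i F i = \sum_i F (psi i).
Proof. exact: reindex_inj. Qed.

Let x_mass_gt0 : 0 < \sum_i x i ^+ 2.
Proof.
case: x_neq0 => v xv; rewrite (bigD1 v) //= ltr_pwDl ?exprn_even_gt0 //.
by apply: sumr_ge0 => i _; rewrite sqr_ge0.
Qed.

Let y_mass_ge : \sum_i x i ^+ 2 <= \sum_i y i ^+ 2.
Proof. by rewrite sum_psi ler_sum. Qed.

Let y_energy_le : \sum_i (y i + y (p' i)) ^+ 2 <= \sum_i (x i + x (p i)) ^+ 2.
Proof. by rewrite [leRHS]sum_psi ler_sum. Qed.

Let q_ge0 : 0 <= q.
Proof.
rewrite -(pmulr_lge0 _ x_mass_gt0) -x_eigen.
by apply: sumr_ge0 => i _; rewrite sqr_ge0.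
Qed.

Hypothesis rayleigh : forall z : 'I_n -> R,
  q' * \sum_i z i ^+ 2 <= \sum_i (z i + z (p' i)) ^+ 2.

(** [q'] times the mass of [y] is at most the energy of [y], hence at most that of [x], which is [q]
    times the mass of [x]; as [q >= 0], this is at most [q] times the mass of [y]. *)
Lemma transplant_le : q' <= q.
Proof.
rewrite -(ler_pM2r (lt_le_trans x_mass_gt0 y_mass_ge)).
apply: le_trans (rayleigh y) _; apply: le_trans y_energy_le _.
by rewrite x_eigen ler_wpM2l.
Qed.

(** If [q = 0], then [x] changes sign along every edge; the odd triangle forces [x c = 0], and the
    zero spreads from the root. *)
Let q_gt0 : 0 < q.
Proof.
rewrite lt_neqAle q_ge0 andbT; apply/negP => /eqP q0.
have x0 i : x i + x (p i) = 0.
  move: x_eigen; rewrite -q0 mul0r => /psumr_eq0P E.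
  by apply/eqP; rewrite -sqrf_eq0 E // => j _; rewrite sqr_ge0.
have := x0 a; have := x0 b; have := x0 c; rewrite (pt_a pt) (pt_b pt) (pt_c pt) => xca xbc xab.
case: x_neq0 => v /eqP; apply; elim/(pt_ind pt): v => [|v _ pv0]; first by lra.
by have := x0 v; rewrite pv0 addr0.
Qed.

(** * The equality case [q = q'] *)

Hypothesis qE : q = q'.
Hypothesis q_lt1 : q' < 1.
Hypothesis vertex_eq : forall (z : 'I_n -> R) u,
  \sum_i (z i + z (p' i)) ^+ 2 = q' * \sum_i z i ^+ 2 ->
  (z u + z (p' u)) + \sum_(i | p' i == u) (z i + z u) = q' * z u.

Let energy_eq : \sum_i (y i + y (p' i)) ^+ 2 = \sum_i (x i + x (p i)) ^+ 2.
Proof.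
apply/le_anti; rewrite y_energy_le x_eigen /=.
apply: le_trans (rayleigh y); rewrite -qE.
by rewrite ler_wpM2l.
Qed.

Let mass_eq : \sum_i x i ^+ 2 = \sum_i y i ^+ 2.
Proof.
apply/le_anti; rewrite y_mass_ge /= -(ler_pM2l q_gt0) -x_eigen -energy_eq qE.
exact: rayleigh.
Qed.

Let y_eigen : \sum_i (y i + y (p' i)) ^+ 2 = q' * \sum_i y i ^+ 2.
Proof. by rewrite energy_eq x_eigen mass_eq qE. Qed.

Lemma transplant_mass_eq i : outer i -> `|x (psi i)| = h i.
Proof.
move=> io; have /eqP := sum_eq_termwise y_mass (etrans (esym (sum_psi _)) mass_eq) i.
rewrite y_outer // sqr_signM -[X in X == _]real_normK ?num_real //.
by rewrite eqrXn2 // ?(le_trans _ (h_dom io)) // => /eqP.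
Qed.

Lemma transplant_step_eq i :
  outer i -> `|x (psi i) + x (p (psi i))| = h i - h (p' i).
Proof.
move=> io; have /eqP := sum_eq_termwise y_energy (etrans energy_eq (sum_psi _)) i.
rewrite y_step // sqr_signM -[X in _ == X]real_normK ?num_real //.
by rewrite eqrXn2 ?subr_ge0 ?h_mono // => /eqP.
Qed.

Let child_outer u i : outer u -> p' i = u -> outer i.
Proof.
move=> uo piu; case: (outerP i) => // E; move: uo; rewrite -piu E.
- by rewrite (pt_a pt') !inE eqxx orbT.
- by rewrite (pt_b pt') !inE eqxx !orbT.
- by rewrite (pt_c pt') mem_head.
Qed.

(** The vertex equation of [y] with the signs cancelled: the increment arriving at [u] splits into
    [q' * h u] and the increments passed on to the children. *)
Let flow u : outer u ->
  h u - h (p' u) = q' * h u + \sum_(i | p' i == u) (h i - h u).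
Proof.
move=> uo; have := vertex_eq u y_eigen; rewrite y_step // y_outer //.
have -> : \sum_(i | p' i == u) (y i + (-1) ^+ t' u * h u) =
    - ((-1) ^+ t' u * \sum_(i | p' i == u) (h i - h u)).
  rewrite mulr_sumr -sumrN; apply: eq_bigr => i /eqP piu.
  have io := child_outer uo piu.
  have [_ _ ic] := outer_neq io.
  rewrite (y_outer io) (pt_step pt' ic) piu exprS; ring.
move=> E; apply: (mulfI (negbT (signr_eq0 R (t' u)))).
by rewrite [RHS]mulrDr [X in _ = X + _]mulrCA -E addrNK.
Qed.

(** If the root value were 0, the whole triangle would vanish, and the vertex equations would carry
    zeros of [h] outwards until [x = 0]. *)
Let h_root_gt0 : 0 < x c.
Proof.
have xc0 : 0 <= x c by case: x_tri => /(le_trans (normr_ge0 _)).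
rewrite lt_neqAle xc0 andbT; apply/negP => /eqP xc.
have [xa xb] : x a = 0 /\ x b = 0.
  by case: x_tri; rewrite -xc !normr_le0 => /eqP -> /eqP ->.
have h0 i : outer i -> 0 <= h i by move=> /h_dom; apply: le_trans.
suff main v : ~~ outer v \/ h v = 0.
  case: x_neq0 => v /eqP; apply; have [g _ gK] := injF_bij psi_inj.
  rewrite -(gK v); have [pa pb pc] := psi_tri; case: (outerP (g v)) => [->|->|->|o].
  - by rewrite pa. - by rewrite pb. - by rewrite pc -xc.
  case: (main (g v)) => [/negP //|hv].
  by apply/eqP; rewrite -normr_le0 -hv h_dom.
(* The induction also carries the outer children: the vertex equation at a zero of [h] makes their
   nonnegative values sum to zero. *)
suff main2 : (~~ outer v \/ h v = 0) /\ (v \notin [:: a'; b'] ->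
     forall i, outer i -> p' i = v -> h i = 0) by case: main2.
elim/(pt_ind pt'): v => [|v vc [_ IH]].
  split; first by left; rewrite !inE eqxx !orbT.
  move=> _.
  have := vertex_eq c' y_eigen; rewrite (pt_c pt') yc ya -xc xa addr0 mulr0 add0r.
  move=> E i io pic.
  have yi j : p' j == c' -> y j + 0 = if outer j then - h j else 0.
    move=> /eqP pj; rewrite addr0; case: ifP => [jo|jo].
      have [_ _ jc] := outer_neq jo.
      by rewrite y_outer // (pt_step pt' jc) pj (pt_root pt') expr1 mulN1r.
    by case: (outerP j) => [->|->|->|o]; rewrite ?ya ?yb ?yc ?xa ?xb -?xc //; rewrite o in jo.
  move: E; rewrite (eq_bigr _ yi) => E.
  have /psumr_eq0P : \sum_(j | p' j == c') - (if outer j then - h j else 0) = 0.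
    by rewrite sumrN E oppr0.
  move=> /(_ _ i); rewrite pic eqxx io opprK; apply=> // j _.
  by case: ifP => jo; rewrite ?oppr0 // opprK h0.
case: (outerP v) => [->|->|vc'|vo].
- by split; [left; rewrite mem_head | rewrite mem_head].
- by split; [left; rewrite !inE eqxx orbT | rewrite !inE eqxx orbT].
- by rewrite vc' eqxx in vc.
have hv : h v = 0 by apply: IH => //; exact: outer_parent.
split=> [|_ i io piv]; first by right.
have hp : h (p' v) = 0.
  case: (outerP (p' v)) => [E|E|E|o].
  - by have := outer_parent vo; rewrite E mem_head.
  - by have := outer_parent vo; rewrite E !inE eqxx orbT.
  - by rewrite E h_root -xc.
  by apply/le_anti; rewrite h0 // -{1}hv h_mono.
have := flow vo; rewrite hv hp mulr0 subrr add0r => /esym/psumr_eq0P E.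
have := E _ i; rewrite piv eqxx subr0; apply=> // j /eqP pj.
by rewrite subr0 h0 // (child_outer vo pj).
Qed.

Let h_gt0 i : outer i -> 0 < h i.
Proof.
elim/(pt_ind pt'): i => [|i ic IH io]; first by rewrite !inE eqxx !orbT.
apply: lt_le_trans (h_mono io); case: (outerP (p' i)) => [E|E|E|/IH //].
- by have := outer_parent io; rewrite E mem_head.
- by have := outer_parent io; rewrite E !inE eqxx orbT.
- by rewrite E h_root.
Qed.

Lemma transplant_strict i : outer i -> h (p' i) < h i.
Proof.
move=> io; rewrite -subr_gt0 flow // ltr_pwDl //.
  by rewrite mulr_gt0 ?h_gt0 // -qE.
apply: sumr_ge0 => j /eqP pj; rewrite subr_ge0 -pj h_mono //.
exact: child_outer io pj.
Qed.

(** No tree hangs on [a'] or [b'], so their vertex equations involve the triangle only. Their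
    difference gives [x a = x b] because [q' < 1], and then [x c = (q' - 3) * x a]. *)
Lemma transplant_triangle_lt : `|x a| < x c /\ `|x b| < x c.
Proof.
have q1 := q_lt1.
have Ea := vertex_eq a' y_eigen.
have Eb := vertex_eq b' y_eigen.
have parent_tri i v : v \in [:: a'; b'] -> p' i = v -> ~ outer i.
  by move=> vab piv /outer_parent; rewrite piv vab.
have sum_a : \sum_(i | p' i == a') (y i + y a') = x c + x a.
  rewrite (bigD1 c') ?(pt_c pt') //= yc ya big1 ?addr0 // => i /andP[/eqP pia ic].
  case: (outerP i) => [E|E|E|o]; last by case: (parent_tri i a') => //; rewrite mem_head.
  - by have := pt_ab pt'; rewrite -{1}pia E (pt_a pt') eqxx.
  - by have := pt_ac pt'; rewrite -{1}pia E (pt_b pt') eqxx.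
  - by rewrite E eqxx in ic.
have sum_b : \sum_(i | p' i == b') (y i + y b') = x a + x b.
  rewrite (bigD1 a') ?(pt_a pt') //= ya yb big1 ?addr0 // => i /andP[/eqP pib ia].
  case: (outerP i) => [E|E|E|o].
  - by rewrite E eqxx in ia.
  - by have := pt_neq pt'; rewrite -{1}pib E (pt_b pt') eqxx.
  - by have := pt_ab pt'; rewrite -pib E (pt_c pt') eqxx.
  - by case: (parent_tri i b') => //; rewrite !inE eqxx orbT.
move: Ea Eb; rewrite sum_a sum_b (pt_a pt') (pt_b pt') ya yb yc => Ea Eb.
have xab : x a = x b.
  have /eqP : (1 - q') * (x a - x b) = 0 by rewrite mulrBl mul1r mulrBr -Ea -Eb; ring.
  rewrite mulf_eq0 => /orP[|]; last by rewrite subr_eq0 => /eqP.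
  by rewrite subr_eq0 => /eqP E; rewrite -E ltxx in q1.
rewrite -xab; suff : `|x a| < x c by [].
apply: triangle_value_lt q1 h_root_gt0 _.
by rewrite mulrBl -Ea -xab; ring.
Qed.

End Transplant.

(** * Rearrangement into H3 *)

(** Greedy choice: for the head [y] of [s] take an element with image [y] or, failing that, one with
    image outside the tail, which exists by pigeonhole. This hangs each leaf on its own parent
    whenever that parent lies on the path. *)
Lemma align_with_images (T : eqType) (f : T -> T) (s l : seq T) :
  uniq (map f l) -> size l = size s ->
  exists2 k, perm_eq k l &
  forall x0 j, (j < size s)%N -> f (nth x0 k j) \in s -> f (nth x0 k j) = nth x0 s j.
Proof.
elim: s l => [|y s IH] l fl_uniq sz; first by exists l.
have [z zl zP] : exists2 z, z \in l & f z = y \/ (y \notin map f l /\ f z \notin s).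
  have [/mapP[z zl ->]|yl] := boolP (y \in map f l); first by exists z => //; left.
  have [/hasP[z zl zs]|] := boolP (has (fun z => f z \notin s) l).
    by exists z => //; right.
  rewrite -all_predC => /allP/= fs; suff : (size l <= size s)%N by rewrite sz ltnn.
  rewrite -(size_map f); apply: uniq_leq_size => // _ /mapP[z zl ->].
  by have := fs z zl; rewrite negbK.
have lE := perm_to_rem zl.
have := fl_uniq; rewrite (perm_uniq (perm_map f lE)) /= => /andP[fz fr_uniq].
have [|k kE kP] := IH (rem z l) fr_uniq; first by rewrite size_rem // sz.
exists (z :: k) => [|x0 [_|j]]; first by rewrite perm_sym (perm_trans lE) // perm_cons perm_sym.
  by rewrite /= inE => /orP[/eqP //|]; case: zP => [//|[_ /negbTE ->]].
rewrite /= ltnS inE => js /orP[/eqP fy|]; last exact: kP.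
have jk : nth x0 k j \in rem z l.
  by rewrite -(perm_mem kE) mem_nth // (perm_size kE) size_rem // sz.
case: zP => [fzy|[yl _]]; first by rewrite -fzy in fy; rewrite -fy map_f in fz.
by rewrite -fy map_f ?(mem_rem jk) // in yl.
Qed.

Section Rearrangement.
Context {R : realFieldType} {n : nat} {p : 'I_n -> 'I_n} {t : 'I_n -> nat} {a b c : 'I_n}.
Hypothesis pt : pointed_triangle p t a b c.

Lemma triangle_parent v : v \in [:: a; b; c] -> p v \in [:: a; b; c].
Proof.
by rewrite !inE => /or3P[]/eqP ->;
  rewrite ?(pt_a pt) ?(pt_b pt) ?(pt_c pt) eqxx ?orbT.
Qed.

Lemma exists_accumulation (r : R) (e : 'I_n -> R) :
  exists g : 'I_n -> R, (forall v, v \in [:: a; b; c] -> g v = r) /\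
    (forall v, v \notin [:: a; b; c] -> g v = g (p v) + e v).
Proof.
(* [w] is cut to zero on the triangle, so summing along the orbit down to [c] counts only the
   increments outside it. *)
pose w v := if v \in [:: a; b; c] then 0 else e v.
exists (fun v => r + \sum_(j < t v) w (iter j p v)); split=> v vtri.
  rewrite big1 ?addr0 // => j _; rewrite /w.
  suff -> : iter j p v \in [:: a; b; c] by [].
  by elim: (j : nat) => //= k /triangle_parent.
have vc : v != c by apply: contraNneq vtri => ->; rewrite !inE eqxx !orbT.
rewrite (pt_step pt vc) big_ord_recl /= {1}/w (negbTE vtri).
rewrite -addrA [e v + _]addrC; congr (_ + (_ + _)).
by apply: eq_bigr => j _; rewrite -iterSr.
Qed.

Lemma exists_sorting (g : 'I_n -> R) (B : {set 'I_n}) :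
  c \notin B -> (forall v, v \in B -> g (p v) <= g v) ->
  exists2 s, [/\ uniq s, size s = #|B| & s =i B] &
  (forall i j, (i < j < size s)%N -> g (nth c s i) <= g (nth c s j)) /\
  (forall j, (j < size s)%N -> p (nth c s j) \in B ->
     exists2 i, (i < j)%N & p (nth c s j) = nth c s i).
Proof.
move=> cB gB.
(* Ties in [g] are broken by depth, so that a parent precedes its child even when their values
   agree. *)
pose lex u v := (g u < g v) || ((g u == g v) && (t u <= t v)%N).
have lexP u v : lex u v = (g u <= g v) && ((g u == g v) ==> (t u <= t v)%N).
  by rewrite /lex le_eqVlt; case: (ltgtP (g u) (g v)).
have lex_total : total lex.
  by move=> u v; rewrite /lex; case: (ltgtP (g u) (g v)) => //= _; exact: leq_total.
have lex_trans : transitive lex.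
  move=> v u w; rewrite !lexP => /andP[uv tuv] /andP[vw tvw].
  rewrite (le_trans uv vw) /=; apply/implyP => /eqP uw.
  have guv : g u == g v by rewrite eq_le uv uw vw.
  have gvw : g v == g w by rewrite -(eqP guv) uw.
  by rewrite guv in tuv; rewrite gvw in tvw; exact: leq_trans tuv tvw.
pose s := sort lex (enum B); have s_sorted : sorted lex s by exact: sort_sorted.
have sB : s =i B by move=> v; rewrite mem_sort mem_enum.
have s_lex i j : (i < j < size s)%N -> lex (nth c s i) (nth c s j).
  move=> /andP[ij js]; apply: (sorted_ltn_nth lex_trans) => //.
  by rewrite inE (ltn_trans ij).
exists s; first by split=> //; rewrite ?sort_uniq ?enum_uniq // size_sort -cardE.
split=> [i j /s_lex|j js pB]; first by rewrite lexP => /andP[].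
set v := nth c s j in pB *; have vB : v \in B by rewrite -sB mem_nth.
have vc : v != c by apply: contraNneq cB => <-.
have ps : p v \in s by rewrite sB.
exists (index (p v) s); last by rewrite nth_index.
rewrite ltnNge leq_eqVlt; apply/negP => /orP[/eqP jE|jlt].
  by have := pt_irr pt v; rewrite {2}/v jE nth_index // eqxx.
have := s_lex j (index (p v) s); rewrite jlt index_mem ps nth_index // => /(_ isT).
by rewrite -/v lexP (pt_step pt vc) ltnn => /andP[vp]; rewrite eq_le vp gB.
Qed.

End Rearrangement.

Lemma dominant_triangle (R : realDomainType) n (G : sgraph n) (x : 'I_n -> R) :
  has_girth G 3 ->
  exists a b c, [/\ G a b, G b c & G c a] /\ (`|x a| <= `|x c| /\ `|x b| <= `|x c|).
Proof.
move=> [[[|u [|v [|w [|? ?]]]]] //= /andP[_ /andP[/and4P[uv vw wu _] _]] _ _].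
have [uv_le|/ltW vu_le] := leP `|x u| `|x v|.
  have [vw_le|/ltW wv_le] := leP `|x v| `|x w|.
    by exists u, v, w; do !split=> //; exact: le_trans vw_le.
  by exists w, u, v.
have [uw_le|/ltW wu_le] := leP `|x u| `|x w|.
  by exists u, v, w; do !split=> //; exact: le_trans uw_le.
by exists v, w, u.
Qed.

(** * Positions in [H3] and the layout of [G] on them *)

Lemma H3_outerE m (i : 'I_m.*2.+3) :
  (i \notin [:: H3_v1; H3_v2; H3_v3]) = (3 <= i)%N.
Proof. by rewrite !inE -!val_eqE /= !inordK //; lia. Qed.

Lemma H3_notin_v12 m (i : 'I_m.*2.+3) : (2 <= i)%N -> i \notin [:: H3_v1; H3_v2].
Proof. by rewrite !inE -!val_eqE /= !inordK //; lia. Qed.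

Lemma H3_parent_path m (i : 'I_m.*2.+3) :
  (3 <= i <= m + 3)%N -> H3_parent i = (i - 1)%N :> nat.
Proof.
by rewrite H3_parentE; case: (H3_parent_natP m i) => [[-> _]|[-> _]|[-> _]|]; lia.
Qed.

Lemma H3_parent_pendant m (i : 'I_m.*2.+3) :
  (m + 3 < i)%N -> H3_parent i = (i - m.+1)%N :> nat.
Proof.
by rewrite H3_parentE; case: (H3_parent_natP m i) => [[-> _]|[-> _]|[-> _]|]; lia.
Qed.

Lemma H3_parent_outer m (i : 'I_m.*2.+3) :
  (3 <= i)%N -> (2 <= H3_parent i <= m + 2)%N.
Proof.
rewrite H3_parentE; have := ltn_ord i.
by case: (H3_parent_natP m i) => [[-> ->]|[-> ->]|[-> ->]|[]] //; lia.
Qed.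

(** For the equality case: values increase strictly along the path, so a vertex among v_3, ...,
    v_(m+3) is recovered from its value. *)
Lemma H3_path_inj d (R : porderType d) m (h : 'I_m.*2.+3 -> R) :
  (forall i : 'I_m.*2.+3, (3 <= i)%N -> (h (H3_parent i) < h i)%O) ->
  forall i j : 'I_m.*2.+3, (2 <= i < m + 3)%N -> (2 <= j < m + 3)%N -> h i = h j -> i = j.
Proof.
move=> h_parent.
have incr (k : nat) (i j : 'I_m.*2.+3) : (2 <= i)%N -> j = (i + k.+1)%N :> nat ->
    (j < m + 3)%N -> (h i < h j)%O.
  elim: k j => [|k IH] j i2 jE jm.
    suff {1}-> : i = H3_parent j by apply: h_parent; lia.
    by apply: val_inj; rewrite /= H3_parent_path; lia.
  apply: lt_trans (h_parent j _); last by lia.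
  by apply: IH; rewrite ?H3_parent_path; lia.
move=> i j /andP[i2 im] /andP[j2 jm] hij; apply: val_inj; have [ij|ji|//] := ltngtP i j.
  by have := incr (j - i.+1)%N i j i2 ltac:(lia) jm; rewrite hij ltxx.
by have := incr (i - j.+1)%N j i j2 ltac:(lia) im; rewrite hij ltxx.
Qed.

(* [lay] lists the vertices of G in the order of the ordinals of H3: first the
   triangle, last m leaves of G with distinct parents, and in between the other
   m vertices sorted by [g]. *)
Record rearrangement (R : realFieldType) m (p : 'I_m.*2.+3 -> 'I_m.*2.+3)
  (a b c : 'I_m.*2.+3) (g : 'I_m.*2.+3 -> R) (lay : 'I_m.*2.+3 -> 'I_m.*2.+3) : Prop :=
  Rearrangement {
    lay_inj : injective lay;
    lay_triangle : [/\ lay H3_v1 = a, lay H3_v2 = b & lay H3_v3 = c];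
    lay_leaf : forall i : 'I_m.*2.+3, (m + 3 <= i)%N -> forall v, p v != lay i;
    lay_mono : forall i : 'I_m.*2.+3, (3 <= i < m + 3)%N -> g (lay (H3_parent i)) <= g (lay i);
    lay_parent : forall i : 'I_m.*2.+3, (3 <= i)%N -> g (p (lay i)) <= g (lay (H3_parent i));
  }.

Lemma exists_rearrangement (R : realFieldType) m p t a b c (e g : 'I_m.*2.+3 -> R) r :
  (0 < m)%N ->
  @pointed_triangle m.*2.+3 p t a b c -> (m <= #|supports p|)%N ->
  (forall v, 0 <= e v) ->
  (forall v, v \in [:: a; b; c] -> g v = r) ->
  (forall v, v \notin [:: a; b; c] -> g v = g (p v) + e v) ->
  exists lay, rearrangement p a b c g lay.
Proof.
move=> m0 pt mS e0 gtri gE.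
have g_ge v : r <= g v.
  elim/(pt_ind pt): v => [|v _ IH]; first by rewrite gtri ?inE ?eqxx ?orbT.
  have [/gtri -> //|/gE ->] := boolP (v \in [:: a; b; c]).
  by rewrite -[r]addr0 lerD.
have [l0 l0m [pl0_uniq l0_leaf]] := leaves_distinct_supports mS.
have l0_uniq : uniq l0 by exact: map_uniq pl0_uniq.
have pl0 v : p v \notin l0.
  by apply/negP => /l0_leaf; rewrite inE imset_f.
have tri_l0 v : v \in [:: a; b; c] -> v \notin l0.
  rewrite !inE => /or3P[]/eqP->; first by rewrite -(pt_c pt).
    by rewrite -(pt_a pt).
  by rewrite -(pt_b pt).
pose B := [set v | (v \notin [:: a; b; c]) && (v \notin l0)].
have tri_uniq : uniq [:: a; b; c].
  by rewrite /= !inE negb_or (pt_ab pt) (pt_ac pt) (pt_neq pt).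
have Bm : #|B| = m.
  have u : uniq ([:: a; b; c] ++ l0).
    rewrite cat_uniq tri_uniq l0_uniq andbT /=; apply/hasPn => v vl.
    by apply/negP => /tri_l0; rewrite vl.
  have := cardC (mem ([:: a; b; c] ++ l0)); rewrite (card_uniqP u) size_cat l0m card_ord.
  have -> : #|[predC [:: a; b; c] ++ l0]| = #|B|.
    by apply: eq_card => v; rewrite [RHS]inE -negb_or -mem_cat.
  by rewrite /=; lia.
have cB : c \notin B by rewrite !inE eqxx !orbT.
have gB v : v \in B -> g (p v) <= g v.
  by rewrite inE => /andP[/gE -> _]; rewrite lerDl.
have [s [s_uniq sm sB] [s_mono s_parent]] := exists_sorting pt cB gB.
rewrite Bm in sm.
have [k kl0 kP] : exists2 k, perm_eq k l0 & forall x0 j, (j < size s)%N ->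
    p (nth x0 k j) \in s -> p (nth x0 k j) = nth x0 s j.
  by apply: align_with_images => //; rewrite l0m sm.
have km : size k = m by rewrite (perm_size kl0).
(* A parent is never a chosen leaf, so outside [B] it lies on the triangle, where [g] takes its
   least value [r]. *)
have pB v : p v \notin B -> g (p v) = r.
  by rewrite inE pl0 andbT negbK => /gtri.
(* The last element of [k] moves to the front: ordinal [m + 3] hangs on the last path vertex
   [m + 2], while the ordinals from [m + 4] on hang on 3, 4, ... in order. *)
pose z := nth c k m.-1; pose k' := take m.-1 k.
have kE : k = rcons k' z by rewrite /k' /z -take_nth ?prednK ?km // take_oversize ?km.
have k'm : size k' = m.-1 by rewrite size_takel // km leq_pred.
pose order := [:: a; b; c] ++ s ++ z :: k'.
have zk'E : perm_eq (z :: k') l0 by rewrite -(perm_rcons z k') -kE.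
have order_size : size order = m.*2.+3.
  by rewrite !size_cat /= sm k'm; lia.
have order_uniq : uniq order.
  rewrite cat_uniq tri_uniq /=; apply/andP; split.
    apply/hasPn => v; rewrite mem_cat sB (perm_mem zk'E) => /orP[|vl].
      by rewrite inE => /andP[].
    by apply/negP => /tri_l0; rewrite vl.
  rewrite cat_uniq s_uniq (perm_uniq zk'E) l0_uniq andbT; apply/hasPn => v.
  by rewrite (perm_mem zk'E) => vl; rewrite /= sB inE vl andbF.
pose lay (i : 'I_m.*2.+3) := nth c order i.
have lay_chain (i : 'I_m.*2.+3) : (3 <= i < m + 3)%N -> lay i = nth c s (i - 3).
  move=> im; rewrite /lay nth_cat /= ltnNge (_ : 2 < i)%N //=; last by lia.
  by rewrite nth_cat sm (_ : i - 3 < m)%N //; lia.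
have lay_end (i : 'I_m.*2.+3) : (m + 3 <= i)%N ->
    exists2 j, (j < m)%N & lay i = nth c k j /\ H3_parent i = (j + 3)%N :> nat.
  move=> im; have in3 := ltn_ord i.
  exists (if i == m + 3 :> nat then m.-1 else i - m - 4)%N; first by case: ifP => /eqP; lia.
  rewrite /lay nth_cat /= ltnNge (_ : 2 < i)%N //=; last by lia.
  rewrite nth_cat sm ltnNge (_ : m <= i - 3)%N //=; last by lia.
  case: eqP => [iE|iE].
    by rewrite iE addnK subnn H3_parent_path ?iE ?leqnn ?leq_addl //; split=> //; lia.
  have {}im : (m + 3 < i)%N by lia.
  rewrite H3_parent_pendant //; split; last by lia.
  rewrite (_ : i - 3 - m = (i - m - 4).+1)%N /=; last by lia.
  by rewrite kE nth_rcons k'm (_ : i - m - 4 < m.-1)%N //; lia.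
have lay2 (i : 'I_m.*2.+3) : i = 2%N :> nat -> lay i = c by rewrite /lay => ->.
exists lay; split.
- move=> i j /eqP; rewrite /lay nth_uniq ?order_size ?ltn_ord // => /eqP.
  exact: val_inj.
- by rewrite /lay !inordK.
- move=> i /lay_end[j jm [-> _]] v; apply: contraNneq (pl0 v) => ->.
  by rewrite -(perm_mem kl0) mem_nth ?km.
- move=> i im; have pE : H3_parent i = (i - 1)%N :> nat.
    by apply: H3_parent_path; lia.
  rewrite (lay_chain i) //; have [i3|i3] := eqVneq (i : nat) 3%N.
    by rewrite lay2 ?pE ?i3 // (gtri c) ?inE ?eqxx ?orbT.
  by rewrite lay_chain pE; [apply: s_mono; rewrite sm; lia | lia].
- move=> i i3; have [im|im] := ltnP i (m + 3); last first.
    have [j jm [-> pE]] := lay_end i im.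
    rewrite lay_chain pE; last by lia.
    rewrite addnK; have [pkB|/pB -> //] := boolP (p (nth c k j) \in B).
    by rewrite kP ?sm // sB.
  have pE : H3_parent i = (i - 1)%N :> nat.
    by apply: H3_parent_path; lia.
  rewrite lay_chain ?i3 //; have [psB|/pB -> //] := boolP (p (nth c s (i - 3)) \in B).
  (* The parent comes earlier in [s], hence no later than the predecessor on the path. *)
  have [||j ji ->] := s_parent (i - 3)%N => //; first by rewrite sm; lia.
  rewrite lay_chain pE; last by lia.
  have [->|jne] := eqVneq j (i - 1 - 3)%N; first by [].
  by apply: s_mono; rewrite sm; lia.
Qed.

(** * Minimality of [H3] and rigidity in case of equality *)

Lemma rearrangement_q_min (R : realType) m (G : sgraph m.*2.+3) p t a b c
    (x e g : 'I_m.*2.+3 -> R) lay :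
  (0 < m)%N ->
  pointed_triangle p t a b c -> functional_edges G p ->
  (exists v, x v != 0) ->
  \sum_i (x i + x (p i)) ^+ 2 = q_min R G * \sum_i x i ^+ 2 ->
  `|x a| <= x c /\ `|x b| <= x c ->
  (forall v, e v = `|x v + x (p v)|) ->
  (forall v, v \in [:: a; b; c] -> g v = x c) ->
  (forall v, v \notin [:: a; b; c] -> g v = g (p v) + e v) ->
  rearrangement p a b c g lay ->
  q_min R (H3 m.*2.+3) <= q_min R G /\
  (q_min R G = q_min R (H3 m.*2.+3) -> isomorphic G (H3 m.*2.+3)).
Proof.
move=> m0 pt GE x0 xq xtri eE gtri gE [inj tri leaf mono par].
have [la lb lc] := tri.
have pt' := H3_pointed_triangle m; have HE := @H3_functional_edges m.
have cE : lay H3_v3 \in [:: a; b; c] by rewrite lc !inE eqxx !orbT.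
have xc0 : 0 <= x c by case: xtri => /(le_trans (normr_ge0 _)).
have g_ge v : x c <= g v.
  elim/(pt_ind pt): v => [|v _ IH]; first by rewrite gtri // !inE eqxx !orbT.
  have [/gtri -> //|/gE ->] := boolP (v \in [:: a; b; c]).
  by rewrite -[x c]addr0 lerD ?eE.
have x_le_g v : `|x v| <= g v.
  elim/(pt_ind pt): v => [|v _ IH]; first by rewrite gtri ?ger0_norm // !inE eqxx !orbT.
  have [vtri|/gE ->] := boolP (v \in [:: a; b; c]).
    rewrite gtri //; case: xtri => xa xb.
    by move: vtri; rewrite !inE => /or3P[]/eqP-> //; rewrite ger0_norm.
  rewrite eE addrC -{1}(addrK (x (p v)) (x v)).
  by apply: le_trans (ler_normB _ _) _; rewrite lerD2l.
(* A pendant vertex keeps the increment of its leaf but starts from the value of its new parent. *)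
pose h (i : 'I_m.*2.+3) :=
  if (i < m + 3)%N then g (lay i) else g (lay (H3_parent i)) + e (lay i).
have outer3 (i : 'I_m.*2.+3) : i \notin [:: H3_v1; H3_v2; H3_v3] -> (3 <= i)%N.
  by rewrite H3_outerE.
have h_parent (i : 'I_m.*2.+3) : (3 <= i)%N -> h (H3_parent i) = g (lay (H3_parent i)).
  move=> i3; rewrite /h; have /andP[_ pm] := H3_parent_outer i3.
  by rewrite (leq_ltn_trans pm) // ltn_add2l.
have lay_outer (i : 'I_m.*2.+3) : (3 <= i)%N -> lay i \notin [:: a; b; c].
  by rewrite -la -lb -lc (mem_map inj [:: H3_v1; H3_v2; H3_v3]) H3_outerE.
have h_root : h H3_v3 = x c by rewrite /h inordK // ltn_addl // gtri.
have outer_parent (i : 'I_m.*2.+3) : i \notin [:: H3_v1; H3_v2; H3_v3] ->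
    H3_parent i \notin [:: H3_v1; H3_v2].
  by move=> /outer3/H3_parent_outer/andP[p2 _]; exact: H3_notin_v12.
have h_mono (i : 'I_m.*2.+3) : i \notin [:: H3_v1; H3_v2; H3_v3] -> h (H3_parent i) <= h i.
  move=> /outer3 i3; rewrite h_parent // /h; case: ifP => im; last by rewrite lerDl eE.
  by apply: mono; rewrite i3.
have h_step (i : 'I_m.*2.+3) : i \notin [:: H3_v1; H3_v2; H3_v3] ->
    h i - h (H3_parent i) <= `|x (lay i) + x (p (lay i))|.
  move=> /outer3 i3; rewrite h_parent // -eE /h; case: ifP => im.
    by rewrite gE ?lay_outer // lerBlDr [leRHS]addrC lerD2r par.
  by rewrite addrAC subrr add0r.
have h_dom (i : 'I_m.*2.+3) : i \notin [:: H3_v1; H3_v2; H3_v3] -> `|x (lay i)| <= h i.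
  move=> /outer3 i3; apply: le_trans (x_le_g _) _; rewrite /h; case: ifP => // im.
  by rewrite gE ?lay_outer // lerD2r par.
have ray := q_min_rayleigh (R := R) pt' HE.
split.
  exact: (transplant_le pt pt' outer_parent inj tri xq x0 h_root h_mono h_step h_dom ray).
move=> qGH.
have lt1 : q_min R (H3 m.*2.+3) < 1.
  apply: (q_min_lt1 (u := inord (m + 3)) pt' HE) => i; rewrite -val_eqE /= inordK; last by lia.
  by rewrite H3_parentE; case: (H3_parent_natP m i) (ltn_ord i) => [[_ ->]|[_ ->]|[_ ->]|]; lia.
have vertex := q_min_vertex_eq (R := R) pt' HE.
have mass_eq i :=
  transplant_mass_eq pt pt' outer_parent inj tri xq x0
    h_root h_mono h_step h_dom ray qGH (i := i).
have step_eq i :=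
  transplant_step_eq pt pt' outer_parent inj tri xq x0
    h_root h_mono h_step h_dom ray qGH (i := i).
have strict i :=
  transplant_strict pt pt' outer_parent inj tri xq x0 xtri
    h_root h_mono h_step h_dom ray qGH vertex (i := i).
have [xa_lt xb_lt] :=
  transplant_triangle_lt pt pt' outer_parent inj tri xq x0 xtri
    h_root h_mono h_step h_dom ray qGH lt1 vertex.
have outerI (i : 'I_m.*2.+3) : (3 <= i)%N -> i \notin [:: H3_v1; H3_v2; H3_v3].
  by rewrite H3_outerE.
have h_inj := H3_path_inj (fun i i3 => strict i (outerI i i3)).
have [lay' layK layK'] := injF_bij inj.
(* Outside the triangle, [p (lay i)] is shown to sit at a path position whose value is that of
   [H3_parent i]; [h_inj] then identifies the two positions. *)
have layP i : p (lay i) = lay (H3_parent i).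
  have [itri|io] := boolP (i \in [:: H3_v1; H3_v2; H3_v3]).
    move: itri; rewrite !inE => /or3P[]/eqP->.
    - by rewrite (pt_a pt') la lb (pt_a pt).
    - by rewrite (pt_b pt') lb lc (pt_b pt).
    - by rewrite (pt_c pt') lc la (pt_c pt).
  have i3 := outer3 _ io; have /andP[p2 pm] := H3_parent_outer i3.
  (* Triangle inequality on the edge from [lay i] to its parent, with mass and step replaced by
     their equality values. *)
  have hp : h (H3_parent i) <= `|x (p (lay i))|.
    have := ler_normB (x (lay i) + x (p (lay i))) (x (p (lay i))).
    by rewrite addrK mass_eq // step_eq // -addrA lerDl addrC subr_ge0.
  set j := lay' (p (lay i)); have jE : lay j = p (lay i) by rewrite layK'.
  rewrite -jE in hp *; congr (lay _).
  have xc_le : x c <= h (H3_parent i) by rewrite h_parent.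
  have jm : (j < m + 3)%N.
    by rewrite ltnNge; apply/negP => /leaf/(_ (lay i)); rewrite jE eqxx.
  have hj : h j <= h (H3_parent i) by rewrite /h jm jE -/(h _) h_parent // par.
  (* The modulus at position [j] is at least [x c], which the strict inequalities at [a] and [b]
     exclude for v_1 and v_2. *)
  have j2 : (2 <= j)%N.
    case jn: (j : nat) => [|[|//]]; move: (le_trans xc_le hp).
      by rewrite (_ : j = H3_v1) ?la ?leNgt ?xa_lt //; apply: val_inj; rewrite /= inordK.
    by rewrite (_ : j = H3_v2) ?lb ?leNgt ?xb_lt //; apply: val_inj; rewrite /= inordK.
  apply: h_inj; rewrite ?j2 ?p2 ?(leq_ltn_trans pm) ?ltn_add2l //.
  apply/le_anti; rewrite hj /=; apply: le_trans hp _.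
  by rewrite /h jm x_le_g.
exists lay'; first by exists lay.
move=> u v; rewrite -[u in RHS]layK' -[v in RHS]layK' GE HE !layP !(inj_eq inj).
by [].
Qed.

Theorem theorem4p4 (R : realType) (n gamma : nat) :
  (5 <= n)%N ->
  (n%:R + 1) / 3 < gamma%:R :> rat ->
  gamma%:R <= n%:R / 2 :> rat ->
  gamma%:R = (n%:R - 1) / 2 :> rat ->
  nonbip_unicyclic 3 gamma (H3 n) /\
  (forall G : sgraph n, nonbip_unicyclic 3 gamma G ->
     q_min R (H3 n) <= q_min R G /\
     (q_min R G = q_min R (H3 n) -> isomorphic G (H3 n))).
Proof.
move=> n5 _ _ gE.
have {gE} nE : n = (gamma.-1).*2.+3.
  have : (gamma.*2 + 1)%:R = n%:R :> rat by rewrite natrD -muln2 natrM gE; lra.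
  by move/eqP; rewrite eqr_nat => /eqP; lia.
have gE : gamma = gamma.-1.+1 by lia.
have m0 : (0 < gamma.-1)%N by lia.
move: (gamma.-1) nE gE m0 n5 => m -> -> m0 _.
split; first exact: H3_nonbip_unicyclic.
move=> G [Guni _ Ggirth Gdom].
have [x x0 xq] := q_min_eigenvector R G (ltn0Sn _).
have [a [b [c [[Gab Gbc Gca] [xa xb]]]]] := dominant_triangle x Ggirth.
have [p [t pt GE]] := functional_graph_of_unicyclic Guni Gab Gbc Gca.
have mS : (m <= #|supports p|)%N.
  (* This reads [3 * (m + 1) <= 2 * m + 3 + #|supports p|]. *)
  by have := domination_number_supports pt GE; rewrite Gdom; lia.
(* The sign [s] makes the root value nonnegative, as the comparison requires. *)
pose s : R := if 0 <= x c then 1 else -1.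
have s2 : s ^+ 2 = 1 by rewrite /s; case: ifP; rewrite ?sqrrN expr1n.
have s_norm : `|s| = 1 by rewrite /s; case: ifP; rewrite ?normrN normr1.
have xcE : s * x c = `|x c|.
  rewrite /s; case: ifP => [/ger0_norm ->|]; first by rewrite mul1r.
  by move/negbT; rewrite -ltNge => /ltr0_norm ->; rewrite mulN1r.
pose y v := s * x v; pose e v := `|y v + y (p v)|.
have [g [gtri gE]] := exists_accumulation pt (y c) e.
have [lay lay_re] := exists_rearrangement m0 pt mS (fun v => normr_ge0 _ : 0 <= e v) gtri gE.
apply: (rearrangement_q_min (x := y) m0 pt GE _ _ _ _ gtri gE lay_re) => //.
- by case: x0 => v xv; exists v; rewrite mulf_neq0 // -normr_eq0 s_norm oner_neq0.
- transitivity (s ^+ 2 * \sum_i (x i + x (p i)) ^+ 2).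
    by rewrite mulr_sumr; apply: eq_bigr => i _; rewrite -exprMn mulrDr.
  rewrite (xq _ _ _ _ _ pt GE) s2 mul1r; congr (_ * _).
  by apply: eq_bigr => i _; rewrite exprMn s2 mul1r.
- by rewrite /y !normrM s_norm !mul1r xcE.
Qed.
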